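(* Let $\mathcal{P}=\langle X\mid R\rangle$ be a finitely generated monoid presentation with solvable Word Problem and whose set of relations is enumerable (in particular, let $R$ be enumerable). Then $\mathcal{P}$ has a solvable Conjugacy Problem if and only if the function $\Gamma:\mathbb{N}^2\to\mathbb{N}$ relative to $\mathcal{P}$ is bounded above by a computable function. Moreover, in this case $\Gamma$ is computable.
   Context: $\mathcal{M}(X)$ is the free monoid on $X$ and $|w|$ the length of a word. $\langle X\mid R\rangle$, with $R\subset\mathcal{M}(X)^2$, presents the monoid $M=\mathcal{M}(X)/\langle R\rangle$, where $\langle R\rangle$ is the congruence generated by $R$; the elements of $\langle R\rangle$ are the relations. Finitely generated means $X$ is finite. Enumerable means recursively enumerable. $\mathcal{P}$ has a solvable Word Problem if $\langle R\rangle$ is a decidable subset of $\mathcal{M}(X)^2$. In a monoid $M$, $a$ is conjugated to $b$ if there exists $t\in M$ with $ta=bt$ (this relation need not be symmetric). $\mathcal{P}$ has a solvable Conjugacy Problem if there is an algorithm deciding, for $a,b\in\mathcal{M}(X)$, whether the element of $M$ represented by $a$ is conjugated to that represented by $b$. For $a_1,a_2\in\mathcal{M}(X)$ such that $a_1$ is conjugated to $a_2$ in $M$, put $\gamma(a_1,a_2)=\min\{|t|: t\in\mathcal{M}(X),\ ta_1=a_2t\text{ in }M\}$; and $\Gamma(n_1,n_2)=\max\{\gamma(a_1,a_2): a_1\text{ is conjugated to }a_2\text{ in }M,\ |a_1|\le n_1,\ |a_2|\le n_2\}$. *)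

(* Defs.v *)
From mathcomp Require Import all_boot.
From mathcomp Require Import boolp classical_sets.

Set Implicit Arguments.
Unset Strict Implicit.
Unset Printing Implicit Defensive.

Local Open Scope classical_set_scope.

(** * Computability: Kleene's partial recursive functions *)

(* [murec n] is the type of definitions of n-ary partial recursive functions. *)
Inductive murec : nat -> Type :=
| MZero n : murec n
| MSucc : murec 1
| MProj n (i : 'I_n) : murec n
| MComp k n (g : murec k) (h : 'I_k -> murec n) : murec n
| MPrec n (g : murec n) (h : murec n.+2) : murec n.+1
| MMu n (g : murec n.+1) : murec n.

(* [meval f x y]: the partial function defined by [f] is defined at [x], with
   value [y].
   - Primitive recursion is on the first argument, and the step function takes
     the counter, the previous value and the parameters, in this order; [s] is
     the sequence of intermediate values.
   - Minimization is on the first argument: [y] is the least zero of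
     [g (_, x)], and [g] must be defined at all smaller arguments. *)
Fixpoint meval n (f : murec n) : n.-tuple nat -> nat -> Prop :=
  match f in murec n return n.-tuple nat -> nat -> Prop with
  | MZero _ => fun _ y => y = 0
  | MSucc => fun x y => y = (thead x).+1
  | MProj _ i => fun x y => y = tnth x i
  | MComp k _ g h => fun x y =>
      exists2 z : k.-tuple nat,
        forall i, meval (h i) x (tnth z i) & meval g z y
  | MPrec n g h => fun x y =>
      exists s : nat -> nat,
        [/\ meval g [tuple of behead x] (s 0),
            forall i, i < thead x ->
              meval h [tuple of i :: s i :: behead x] (s i.+1)
          & y = s (thead x)]
  | MMu n g => fun x y =>
      meval g [tuple of y :: x] 0 /\
      forall i, i < y -> exists v, meval g [tuple of i :: x] v.+1
  end.

Lemma meval_fun n (f : murec n) x y y' : meval f x y -> meval f x y' -> y = y'.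
Proof.
elim: f x y y' => {n}
  [n||n i|k n g IHg h IHh|n g IHg h IHh|n g IHg] x y y' /=; try by move=> -> ->.
- case=> z hz gz [z' hz' gz'].
  suff Ez : z = z' by apply: IHg gz _; rewrite Ez.
  by apply: eq_from_tnth => i; apply: IHh (hz i) (hz' i).
- case=> s [s0 sS ->] [s' [s'0 s'S ->]].
  suff Es i : i <= thead x -> s i = s' i by apply: Es.
  elim: i => [_|i IHi lti]; first exact: IHg s0 s'0.
  by apply: IHh (sS _ lti) _; rewrite IHi ?(ltnW lti)//; apply: s'S.
- case=> gy lty [gy' lty'].
  case: (ltngtP y y') => // [/lty'|/lty] [v gv].
  + by have := IHg _ _ _ gy gv.
  + by have := IHg _ _ _ gy' gv.
Qed.

Definition computable1 (f : nat -> nat) : Prop :=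
  exists c : murec 1, forall m, meval c [tuple m] (f m).

Definition computable2 (f : nat -> nat -> nat) : Prop :=
  exists c : murec 2, forall m n, meval c [tuple m; n] (f m n).

(** * Decidable and enumerable sets of pairs of words *)

(* Goedel numbering of the words on a finite alphabet; [CodeSeq.code] is the
   explicit bijection from [seq nat] to [nat]. *)
Definition wcode (X : finType) (w : seq X) : nat :=
  CodeSeq.code [seq nat_of_ord (enum_rank x) | x <- w].

Definition decidable_pairs (X : finType) (P : set (seq X * seq X)) : Prop :=
  exists c : murec 2, forall u v,
    exists2 b : bool, meval c [tuple wcode u; wcode v] b & (P (u, v) <-> b).

(* [(e1, e2)] may take values that are not codes of pairs of words: these
   values are ignored, so the empty set is enumerable. *)
Definition enumerable_pairs (X : finType) (P : set (seq X * seq X)) : Prop :=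
  exists e1 e2 : nat -> nat, [/\ computable1 e1, computable1 e2 &
    forall u v, P (u, v) <-> exists n, e1 n = wcode u /\ e2 n = wcode v].

(** * Monoid presentations *)

Definition congruence (X : Type) (E : set (seq X * seq X)) : Prop :=
  [/\ forall u, E (u, u),
      forall u v, E (u, v) -> E (v, u),
      forall u v w, E (u, v) -> E (v, w) -> E (u, w)
    & forall u u' v v', E (u, u') -> E (v, v') -> E (u ++ v, u' ++ v')].

(* Equality in the monoid presented by [<X | R>] of the elements represented by
   two words is membership in [relations R]. *)
Definition relations (X : Type) (R : set (seq X * seq X)) :
  set (seq X * seq X) := smallest (@congruence X) R.

Definition conjugates (X : Type) (R : set (seq X * seq X)) (a b t : seq X) :
  Prop := relations R (t ++ a, b ++ t).

Definition conjugated (X : Type) (R : set (seq X * seq X)) (a b : seq X) :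
  Prop := exists t, conjugates R a b t.

Definition solvable_word_problem (X : finType) (R : set (seq X * seq X)) :
  Prop := decidable_pairs (relations R).

Definition solvable_conjugacy_problem (X : finType)
  (R : set (seq X * seq X)) : Prop :=
  decidable_pairs [set p | conjugated R p.1 p.2].

Lemma conjugator_length (X : Type) (R : set (seq X * seq X)) (a b : seq X) :
  conjugated R a b ->
  exists n, `[< exists2 t, size t = n & conjugates R a b t >].
Proof. by case=> t tP; exists (size t); apply/asboolP; exists t. Qed.

(* The value 0 when [a] is not conjugated to [b] is a dummy one, which is not
   used in [Gamma]. *)
Definition gamma (X : Type) (R : set (seq X * seq X)) (a b : seq X) : nat :=
  if pselect (conjugated R a b) is left ab then ex_minn (conjugator_length ab)
  else 0.

(* [{bseq n of X}] is the finite type of the words of length at most [n]. The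
   maximum is over a nonempty set, as the empty word is conjugated to itself. *)
Definition Gamma (X : finType) (R : set (seq X * seq X)) (n1 n2 : nat) : nat :=
  \max_(a : {bseq n1 of X} * {bseq n2 of X} | `[< conjugated R a.1 a.2 >])
     gamma R a.1 a.2.

(* Main.v *)
Require Import Defs.
From mathcomp Require Import all_boot.
From mathcomp Require Import boolp classical_sets.

(* A bound on the length of the conjugators turns the search for a conjugator
   into a bounded one, each step of which is an instance of the Word Problem.
   Conversely, [Gamma R n1 n2 <= n] means that any two words of lengths at most
   [n1] and [n2] which are conjugated have a conjugator of length at most [n]:
   if conjugacy is decidable, this is a decidable property of [n1], [n2], [n],
   and [Gamma R n1 n2] is found by minimization. *)

Set Implicit Arguments.
Unset Strict Implicit.
Unset Printing Implicit Defensive.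

(** * Closure properties of computable functions and decidable tests *)

(** Functions act on plain lists, and only their values on lists of length [n] matter. Changing the
    number of arguments then needs no cast between tuple types. *)
Definition computes n (f : seq nat -> nat) : Prop :=
  exists c : murec n, forall x : n.-tuple nat, meval c x (f x).

(** Through the coercion of Booleans to 0 and 1, tests can be combined by arithmetic. *)
Definition decides n (p : seq nat -> bool) : Prop := computes n p.

Lemma eq_computes n (f g : seq nat -> nat) :
  (forall x : n.-tuple nat, f x = g x) -> computes n f -> computes n g.
Proof. by move=> fg [c cP]; exists c => x; rewrite -fg. Qed.

Lemma eq_decides n (p q : seq nat -> bool) :
  (forall x : n.-tuple nat, p x = q x) -> decides n p -> decides n q.
Proof. by move=> pq; apply: eq_computes => x; rewrite pq. Qed.

Lemma computes_comp k n f (g : seq nat -> seq nat) :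
  computes k f -> (forall x : n.-tuple nat, size (g x) = k) ->
  (forall i, i < k -> computes n (fun x => nth 0 (g x) i)) ->
  computes n (fun x => f (g x)).
Proof.
case=> c cP sg gP.
have /fin_all_exists[h hP] (i : 'I_k) :
  exists d : murec n, forall x : n.-tuple nat, meval d x (nth 0 (g x) i).
  exact: gP.
exists (MComp c h) => x /=.
have sgx : size (g x) == k by rewrite sg.
exists (Tuple sgx); last exact: cP (Tuple sgx).
by move=> i; rewrite (tnth_nth 0); apply: hP.
Qed.

Lemma computes_nth n i : i < n -> computes n (fun x => nth 0 x i).
Proof.
by move=> lin; exists (MProj (Ordinal lin)) => x /=; rewrite (tnth_nth 0).
Qed.

Lemma computes_head n : computes n.+1 (head 0).
Proof.
by apply: eq_computes (@computes_nth n.+1 0 _) => // x; rewrite nth0.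
Qed.

Lemma computes_behead n f :
  computes n f -> computes n.+1 (fun x => f (behead x)).
Proof.
move=> fP; apply: (computes_comp fP) => [x|i lin].
  by rewrite size_behead size_tuple.
apply: eq_computes (@computes_nth n.+1 i.+1 lin) => x.
by rewrite nth_behead.
Qed.

Lemma computes_behead2 n f :
  computes n f -> computes n.+2 (fun x => f (behead (behead x))).
Proof.
move=> fP; apply: (computes_behead (f := fun x => f (behead x))).
exact: computes_behead.
Qed.

(** The argument list serves as an environment: a newly bound value is put at its head, and the
    former arguments are reached by [behead]. *)
Lemma computes_let n a (f : nat -> seq nat -> nat) :
  computes n a -> computes n.+1 (fun x => f (head 0 x) (behead x)) ->
  computes n (fun x => f (a x) x).
Proof.
move=> aP fP.
apply: (computes_comp (g := fun x => a x :: x) fP) => [x|[|i] //= lin].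
  by rewrite /= size_tuple.
exact: computes_nth.
Qed.

Lemma computable2P f :
  computable2 f <-> computes 2 (fun x => f (nth 0 x 0) (nth 0 x 1)).
Proof.
split=> -[c cP]; exists c => x; last by move=> y; apply: cP [tuple x; y].
by case/tupleP: x => m x; case/tupleP: x => p x; rewrite [x]tuple0; apply: cP.
Qed.

Lemma computes_app2 n f a b :
  computable2 f -> computes n a -> computes n b ->
  computes n (fun x => f (a x) (b x)).
Proof.
move=> /computable2P fP aP bP.
by apply: (computes_comp (g := fun x => [:: a x; b x]) fP) => [//|[|[|]]].
Qed.

Lemma computes_succ n f : computes n f -> computes n (fun x => (f x).+1).
Proof.
move=> fP; have sP : computes 1 (fun x => (head 0 x).+1).
  by exists MSucc => x /=; case/tupleP: x.
by apply: (computes_comp (g := fun x => [:: f x]) sP) => [//|[|]].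
Qed.

Lemma computes_const n k : computes n (fun=> k).
Proof.
by elim: k => [|k IHk]; [exists (MZero n)|apply: computes_succ].
Qed.

(** [f] is an existing function known by its recurrence. Its successive values at fixed parameters
    are the intermediate sequence required by [MPrec]. *)
Lemma computes_rec n (f : nat -> seq nat -> nat) h a :
  computes n a -> computes n (f 0) ->
  computes n.+2
    (fun x => h (head 0 x) (head 0 (behead x)) (behead (behead x))) ->
  (forall i x, f i.+1 x = h i (f i x) x) ->
  computes n (fun x => f (a x) x).
Proof.
move=> aP [g gP] [c cP] fS; apply: computes_let aP _.
exists (MPrec g c) => x; exists (f^~ (behead x)).
case/tupleP: x => m x /=; split=> //.
- exact: gP [tuple of behead (m :: x)].
- by move=> i _; rewrite fS; apply: cP [tuple of i :: f i x :: behead (m :: x)].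
Qed.

(** The least [m] with [f x <= m] is [f x] itself, so minimization finds it, and the search always
    ends. *)
Lemma computes_le n f :
  decides n.+1 (fun x => f (behead x) <= head 0 x) -> computes n f.
Proof.
move=> fP; have [c cP] : computes n.+1 (fun x => f (behead x) > head 0 x).
  apply: (eq_computes (f := fun x => (f (behead x) <= head 0 x) == 0 :> nat)).
    by move=> x; rewrite ltnNge; case: leqP.
  (* Negation by recursion on the truth value: 1 at 0, and 0 at every successor. *)
  by apply: (computes_rec (f := fun k _ => k == 0 :> nat)
      (h := fun _ _ _ => 0) fP);
    first [exact: computes_const | done].
exists (MMu c) => x; split=> [|i lti].
  by have := cP [tuple of f x :: x]; rewrite /= ltnn.
by exists 0; have := cP [tuple of i :: x]; rewrite /= lti.
Qed.

Lemma computes_add n f g :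
  computes n f -> computes n g -> computes n (fun x => f x + g x).
Proof.
move=> fP gP.
apply: (computes_rec (f := fun i x => i + g x)
  (h := fun _ r _ => r.+1) fP) => //.
exact/computes_succ/computes_behead/computes_head.
Qed.

Lemma computes_pred n f : computes n f -> computes n (fun x => (f x).-1).
Proof.
move=> fP.
apply: (computes_rec (f := fun i _ => i.-1) (h := fun i _ _ => i) fP) => //.
  exact: computes_const.
exact: computes_head.
Qed.

Lemma computes_mul n f g :
  computes n f -> computes n g -> computes n (fun x => f x * g x).
Proof.
move=> fP gP.
apply: (computes_rec (f := fun i x => i * g x) (h := fun _ r x => g x + r) fP).
- exact: computes_const.
- apply: computes_add; first exact/computes_behead2.
  exact/computes_behead/computes_head.
- by move=> i x; rewrite mulSn.
Qed.

Lemma computes_exp n f g :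
  computes n f -> computes n g -> computes n (fun x => f x ^ g x).
Proof.
move=> fP gP.
apply: (computes_rec (f := fun i x => f x ^ i) (h := fun _ r x => f x * r) gP).
- exact: computes_const.
- apply: computes_mul; first exact/computes_behead2.
  exact/computes_behead/computes_head.
- by move=> i x; rewrite expnS.
Qed.

Lemma computes_sub n f g :
  computes n f -> computes n g -> computes n (fun x => f x - g x).
Proof.
move=> fP gP.
apply: (computes_rec (f := fun i x => f x - i) (h := fun _ r _ => r.-1) gP).
- by apply: eq_computes fP => x; rewrite subn0.
- exact/computes_pred/computes_behead/computes_head.
- by move=> i x; rewrite subnS.
Qed.

Lemma decides_leq n f g :
  computes n f -> computes n g -> decides n (fun x => f x <= g x).
Proof.
move=> fP gP; apply: (eq_computes (f := fun x => 1 - (f x - g x))) => [x|].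
  by rewrite /leq; case: (f x - g x) => [|[]].
by apply: computes_sub; [apply: computes_const|apply: computes_sub].
Qed.

Lemma decides_and n p q :
  decides n p -> decides n q -> decides n (fun x => p x && q x).
Proof.
move=> pP qP; apply: eq_computes (computes_mul pP qP) => x.
by rewrite mulnb.
Qed.

Lemma decides_not n p : decides n p -> decides n (fun x => ~~ p x).
Proof.
move=> pP; apply: eq_computes (computes_sub (computes_const n 1) pP) => x.
by case: (p x).
Qed.

Lemma decides_or n p q :
  decides n p -> decides n q -> decides n (fun x => p x || q x).
Proof.
move=> /decides_not pP /decides_not qP.
apply: eq_decides (decides_not (decides_and pP qP)) => x.
by rewrite negb_and !negbK.
Qed.

Lemma decides_imp n p q :
  decides n p -> decides n q -> decides n (fun x => p x ==> q x).
Proof.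
move=> /decides_not pP qP.
by apply: eq_decides (decides_or pP qP) => x; rewrite implybE.
Qed.

Lemma decides_eq n f g :
  computes n f -> computes n g -> decides n (fun x => f x == g x).
Proof.
move=> fP gP.
apply: eq_decides (decides_and (decides_leq fP gP) (decides_leq gP fP)).
by move=> x; rewrite eqn_leq.
Qed.

Lemma computes_if n p f g : decides n p -> computes n f -> computes n g ->
  computes n (fun x => if p x then f x else g x).
Proof.
move=> pP fP gP; apply: eq_computes (computes_add (computes_mul pP fP)
  (computes_mul (decides_not pP) gP)) => x.
by case: (p x); rewrite mul1n mul0n ?addn0.
Qed.

Lemma decides_has n a (p : nat -> seq nat -> bool) :
  computes n a -> decides n.+1 (fun x => p (head 0 x) (behead x)) ->
  decides n (fun x => has (p^~ x) (iota 0 (a x))).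
Proof.
move=> aP pP.
(* The truth value found so far is carried as a number [r], and read back as [0 < r]. *)
apply: (computes_rec (f := fun i x => has (p^~ x) (iota 0 i))
  (h := fun i r x => nat_of_bool ((0 < r) || p i x)) aP).
- exact: computes_const.
- apply: (decides_or (p := fun x => 0 < head 0 (behead x))
    (q := fun x => p (head 0 x) (behead (behead x)))).
    apply: decides_leq; first exact: computes_const.
    exact/computes_behead/computes_head.
  apply: (computes_comp (g := fun x => head 0 x :: behead (behead x)) pP).
    by move=> x /=; rewrite !size_behead size_tuple.
  case=> [_|i lin] /=; first exact: computes_head.
  exact: (computes_behead2 (@computes_nth n i lin)).
- move=> i x; rewrite -addn1 iotaD has_cat /= orbF add0n.
  by case: (has _ _).
Qed.

(** * Binary shape of the codes of sequences *)

Lemma code_cons n s : CodeSeq.code (n :: s) = 2 ^ n * (CodeSeq.code s).*2.+1.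
Proof. by []. Qed.

(** [up_log 2 c.+1] is the number of binary digits of [c], and an entry [n] contributes [n] zeros
    and a one. *)
Lemma up_log_code s : up_log 2 (CodeSeq.code s).+1 = sumn s + size s.
Proof.
(* Only nonempty sequences are bracketed between consecutive powers of 2: the code 0 of the empty
   one has no leading digit. *)
have codeP n t : 2 ^ (sumn (n :: t) + size t) <= CodeSeq.code (n :: t)
    < 2 ^ (sumn (n :: t) + size (n :: t)).
  elim: t n => [|m t IHt] n.
    by rewrite code_cons /= !addn0 muln1 leqnn addn1 ltn_exp2l//=.
  rewrite code_cons -[sumn (n :: _)]/(n + sumn (m :: t)).
  rewrite -[size (n :: _)]/(size t).+2 -[size (m :: t)]/(size t).+1.
  move: (sumn _) (CodeSeq.code _) (IHt m) => k c.
  rewrite -!addnA !(expnD 2 n) leq_mul2l ltn_mul2l !expn_gt0 expn_eq0 /=.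
  rewrite !addnS !expnS !mul2n ltn_Sdouble => /andP[le lt].
  by rewrite lt andbT leqW ?leq_double.
case: s => [|n s] //; rewrite [size _]/= addnS.
by apply: up_log_eq => //; rewrite ltnS -addnS.
Qed.

(* In binary, [CodeSeq.code s] is made of one block per entry of [s], starting
   from the low bits, so that [t] is coded above the leading bit of [s]. *)
Lemma code_cat s t : CodeSeq.code (s ++ t) =
  CodeSeq.code s + 2 ^ up_log 2 (CodeSeq.code s).+1 * CodeSeq.code t.
Proof.
rewrite up_log_code; elim: s => [|n s IHs]; first by rewrite mul1n.
rewrite cat_cons !code_cons IHs doubleD -addSn mulnDr; congr (_ + _).
rewrite -[sumn (n :: s)]/(n + sumn s) -[size (n :: s)]/(size s).+1.
by rewrite addnS -addnA expnS (expnD 2 n) -mul2n !mulnA [2 ^ n * 2]mulnC.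
Qed.

(** * Encoding and decoding of words *)

Section Words.
Variable X : finType.
Implicit Types (u v w : seq X) (c d n : nat).

Lemma wcode_cons x w : wcode (x :: w) = 2 ^ enum_rank x * (wcode w).*2.+1.
Proof. by []. Qed.

Lemma wcode_inj : injective (@wcode X).
Proof.
move=> u v /(can_inj CodeSeq.codeK).
by apply: inj_map => x y /val_inj/enum_rank_inj.
Qed.

(** A letter of rank [i < #|X|] takes [i.+1 <= #|X|] binary digits. This makes a search among words
    of bounded length a search among bounded numbers. *)
Lemma wcode_ub w : wcode w < 2 ^ (#|X| * size w).
Proof.
elim: w => [|x w IHw]; first by rewrite muln0.
rewrite wcode_cons -[size (x :: w)]/(size w).+1 (mulnS #|X|) expnD.
have ltx := ltn_ord (enum_rank x).
apply: (@leq_trans (2 ^ (enum_rank x).+1 * 2 ^ (#|X| * size w))).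
  by rewrite expnS [2 * _]mulnC -mulnA ltn_pmul2l ?expn_gt0// mul2n ltn_Sdouble.
by rewrite leq_mul2r expn_eq0 /= leq_exp2l.
Qed.

Lemma size_le_wcode w : size w <= wcode w.
Proof.
elim: w => // x w IHw; rewrite wcode_cons.
apply: leq_trans (leq_pmull _ _); last by rewrite expn_gt0.
by rewrite ltnS -addnn (leq_trans IHw) ?leq_addr.
Qed.

(* The alternative [d == c] makes the search for [tailcode c] total; it is the
   only one for [c = 0], and for the [c] that do not start with a letter. *)
Definition is_tailcode d c : bool :=
  (d == c) || has (fun i => c == 2 ^ i * d.*2.+1) (iota 0 #|X|).

Lemma ex_tailcode c : exists d, is_tailcode d c.
Proof. by exists c; rewrite /is_tailcode eqxx. Qed.

Definition tailcode c := ex_minn (ex_tailcode c).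

Lemma tailcode0 : tailcode 0 = 0.
Proof.
rewrite /tailcode; case: ex_minnP => d _ /(_ 0).
by rewrite leqn0 => /(_ _)/eqP->.
Qed.

(** The number [wcode w] is a candidate smaller than [wcode (x :: w)], so the least candidate is not
    the degenerate one. It is then determined by the uniqueness of the decomposition into a power of
    2 and an odd number. *)
Lemma tailcode_cons x w : tailcode (wcode (x :: w)) = wcode w.
Proof.
have xw : is_tailcode (wcode w) (wcode (x :: w)).
  apply/orP; right; apply/hasP; exists (enum_rank x : nat).
    by rewrite mem_iota add0n ltn_ord.
  by rewrite wcode_cons.
have wlt : wcode w < wcode (x :: w).
  rewrite wcode_cons; apply: leq_trans (leq_pmull _ _); last first.
    by rewrite expn_gt0.
  by rewrite ltnS -addnn leq_addr.
rewrite /tailcode; case: ex_minnP => d dP /(_ _ xw) led.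
case/orP: dP => [/eqP Ed|/hasP[i _ /eqP]].
  by move: wlt; rewrite -Ed ltnNge led.
(* This uniqueness is read off from the injectivity of [CodeSeq.code]. *)
move=> E; have /(congr1 CodeSeq.decode) : CodeSeq.code (i :: CodeSeq.decode d) =
  CodeSeq.code [seq enum_rank y : nat | y <- x :: w].
  by rewrite code_cons CodeSeq.decodeK -E.
rewrite !CodeSeq.codeK => -[_ /(congr1 CodeSeq.code)].
by rewrite CodeSeq.decodeK.
Qed.

(** Each step removes one letter, and 0 is fixed. A number that is not the code of a word ends at a
    nonzero fixed point of [tailcode]. *)
Lemma iter_tailcode_eq0P n c :
  reflect (exists2 w : seq X, size w <= n & wcode w = c)
    (iter n tailcode c == 0).
Proof.
apply: (iffP eqP) => [|[w]]; last first.
  elim: w n c => [|x w IHw] n c len <-.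
    by elim: n {len} => //= n ->; apply: tailcode0.
  by case: n len => // n len; rewrite iterSr tailcode_cons; apply: IHw.
elim: n c => [|n IHn] c; first by move=> /= ->; exists [::].
rewrite iterSr => /IHn[w len].
rewrite /tailcode; case: ex_minnP => d dP _ Ed; subst d.
case/orP: dP => [/eqP Ew|/hasP[i]]; first by exists w; rewrite // ltnW.
rewrite mem_iota add0n => /= lti /eqP Ec.
by exists (enum_val (Ordinal lti) :: w); rewrite // wcode_cons enum_valK.
Qed.

Definition word c : seq X := xget [::] [set w | wcode w = c].

Lemma wcodeK : cancel (@wcode X) word.
Proof.
by move=> w; rewrite /word; case: xgetP => [v _ /wcode_inj|/(_ w)] //=.
Qed.

(** This makes [word], defined by choice, computable: a word is no longer than its code, so [c]
    steps suffice to test whether [c] is a code. *)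
Lemma wcode_word c :
  wcode (word c) = if iter c tailcode c == 0 then c else 0.
Proof.
case: iter_tailcode_eq0P => [[w _ <-]|cN]; first by rewrite wcodeK.
rewrite /word; case: xgetP => // v _ cv.
by case: cN; exists v; rewrite // -cv size_le_wcode.
Qed.

(** * Computable operations on words and bounded quantification over words *)

Definition wcomputes n (f : seq nat -> seq X) :=
  computes n (fun x => wcode (f x)).

Lemma computes_tailcode n f :
  computes n f -> computes n (fun x => tailcode (f x)).
Proof.
move=> fP; apply: computes_le.
pose p d (x : seq nat) := is_tailcode d (f (behead x)).
(* By minimality, [tailcode c <= m] amounts to the existence of a candidate [d <= m], which is a
   bounded search. *)
apply: (eq_decides (p := fun x => has (p^~ x) (iota 0 (head 0 x).+1))).
  move=> x; rewrite /tailcode /p; case: ex_minnP => d dP dmin.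
  apply/hasP/idP => [[e]|led]; last by exists d; rewrite // mem_iota.
  by rewrite mem_iota ltnS => /= led /dmin/leq_trans->.
apply: decides_has; first exact/computes_succ/computes_head.
have f2 := computes_behead2 fP.
apply: decides_or; first by apply: decides_eq; first exact: computes_head.
apply: (decides_has (p := fun i x =>
  f (behead (behead x)) == 2 ^ i * (head 0 x).*2.+1)).
  exact: computes_const.
apply: decides_eq.
  by apply: (computes_behead (f := fun x => f (behead (behead x)))).
apply: computes_mul; first by apply: computes_exp;
  [exact: computes_const|exact: computes_head].
apply: computes_succ.
apply: (eq_computes (f := fun x => 2 * head 0 (behead x))) => [x|].
  by rewrite mul2n.
apply: computes_mul; first exact: computes_const.
exact/computes_behead/computes_head.
Qed.

Lemma computes_iter_tailcode n f g : computes n f -> computes n g ->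
  computes n (fun x => iter (f x) tailcode (g x)).
Proof.
move=> fP gP; apply: (computes_rec (f := fun i x => iter i tailcode (g x))
  (h := fun _ r _ => tailcode r) fP) => //.
exact/computes_tailcode/computes_behead/computes_head.
Qed.

Lemma wcomputes_word n f : computes n f -> wcomputes n (fun x => word (f x)).
Proof.
move=> fP; apply: (eq_computes (f := fun x =>
  if iter (f x) tailcode (f x) == 0 then f x else 0)).
  by move=> x; rewrite wcode_word.
apply: computes_if => //; last exact: computes_const.
apply: decides_eq; last exact: computes_const.
exact: computes_iter_tailcode.
Qed.

Lemma wcomputes_cat n f g : wcomputes n f -> wcomputes n g ->
  wcomputes n (fun x => f x ++ g x).
Proof.
move=> fP gP; apply: (eq_computes (f := fun x =>
  wcode (f x) + 2 ^ up_log 2 (wcode (f x)).+1 * wcode (g x))).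
  by move=> x; rewrite /wcode map_cat code_cat.
apply: computes_add => //; apply: computes_mul => //.
apply: computes_exp; first exact: computes_const.
(* The exponent is found by minimization, since [up_log 2 c.+1 <= m] means [c < 2 ^ m]. *)
apply: computes_le.
apply: (eq_decides (p := fun x => (wcode (f (behead x))).+1 <= 2 ^ head 0 x)).
  move=> x; apply/idP/idP => [|le]; first exact: up_log_min.
  apply: leq_trans (up_logP (wcode (f (behead x))).+1 (ltnSn 1)) _.
  by rewrite leq_exp2l.
apply: decides_leq; first exact: (computes_succ (computes_behead fP)).
by apply: computes_exp; [apply: computes_const|apply: computes_head].
Qed.

Lemma decides_pairs n (P : set (seq X * seq X)) f g : decidable_pairs P ->
  wcomputes n f -> wcomputes n g -> decides n (fun x => `[< P (f x, g x) >]).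
Proof.
case=> c cP [cf cfP] [cg cgP].
exists (MComp c (tnth [tuple cf; cg])) => x.
exists [tuple wcode (f x); wcode (g x)].
  by case=> [[|[|i]] lti].
have [b bP fgb] := cP (f x) (g x).
by suff -> : `[< P (f x, g x) >] = b by []; apply/asboolP/idP; case: fgb.
Qed.

Lemma decidable_pairsP (P : set (seq X * seq X)) :
  decidable_pairs P <->
  decides 2 (fun x => `[< P (word (nth 0 x 0), word (nth 0 x 1)) >]).
Proof.
split=> [PP|[c cP]].
  by apply: decides_pairs => //; apply: wcomputes_word; apply: computes_nth.
exists c => u v; exists `[< P (u, v) >]; last by rewrite asboolE.
by have := cP [tuple wcode u; wcode v]; rewrite /= !wcodeK.
Qed.

(** The codes of the words of length at most [m x] lie below [2 ^ (#|X| * m x)], where iterating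
    [tailcode] recognizes them. *)
Lemma decides_exists_word n (p : seq X -> seq nat -> bool) m :
  computes n m -> decides n.+1 (fun x => p (word (head 0 x)) (behead x)) ->
  decides n (fun x => `[< exists2 w, size w <= m x & p w x >]).
Proof.
move=> mP pP; apply: (eq_decides (p := fun x =>
  has (fun c => (iter (m x) tailcode c == 0) && p (word c) x)
      (iota 0 (2 ^ (#|X| * m x))))) => [x|].
  apply/hasP/asboolP => [[c _ /andP[/iter_tailcode_eq0P[w lew <-]]]|[w lew pw]].
    by rewrite wcodeK => pw; exists w.
  exists (wcode w); last first.
    by rewrite wcodeK pw andbT; apply/iter_tailcode_eq0P; exists w.
  rewrite mem_iota /= add0n (leq_trans (wcode_ub w))// leq_exp2l//.
  by rewrite leq_mul2l lew orbT.
apply: (decides_has (p := fun c x =>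
  (iter (m x) tailcode c == 0) && p (word c) x)).
  apply: computes_exp; first exact: computes_const.
  by apply: computes_mul => //; apply: computes_const.
apply: decides_and pP; apply: decides_eq; last exact: computes_const.
by apply: computes_iter_tailcode; [apply: computes_behead|apply: computes_head].
Qed.

Lemma decides_forall_word n (p : seq X -> seq nat -> bool) m :
  computes n m -> decides n.+1 (fun x => p (word (head 0 x)) (behead x)) ->
  decides n (fun x => `[< forall w, size w <= m x -> p w x >]).
Proof.
move=> mP /decides_not pP.
have := decides_not (decides_exists_word (p := fun w x => ~~ p w x) mP pP).
apply: eq_decides => x; apply/asboolPn/asboolP => [pN w lew|pw [w /pw->]//].
by apply/negPn/negP => pwN; apply: pN; exists w.
Qed.

(** * Conjugators and the function [Gamma] *)

Variable R : set (seq X * seq X).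

Lemma conjugated_gamma a b n :
  conjugated R a b -> (gamma R a b <= n) <->
  (exists2 t, size t <= n & conjugates R a b t).
Proof.
move=> ab; rewrite /gamma; case: pselect => // ab'.
case: ex_minnP => k /asboolP[t <- tP] kmin; split=> [le|[s le sP]].
  by exists t.
by apply: leq_trans le; apply: kmin; apply/asboolP; exists s.
Qed.

Lemma Gamma_leP n1 n2 n : Gamma R n1 n2 <= n <->
  forall a, size a <= n1 -> forall b, size b <= n2 -> conjugated R a b ->
    exists2 t, size t <= n & conjugates R a b t.
Proof.
split=> [/bigmax_leqP le a lea b leb ab|H].
  apply/conjugated_gamma => //.
  by apply: (le (Bseq lea, Bseq leb)); apply/asboolP.
apply/bigmax_leqP => -[[a lea] [b leb]] /asboolP/= ab.
by apply/conjugated_gamma => //; apply: H.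
Qed.

Hypothesis wordP : solvable_word_problem R.

Lemma decides_short_conjugator n f g m :
  wcomputes n f -> wcomputes n g -> computes n m ->
  decides n (fun x =>
    `[< exists2 t, size t <= m x & `[< conjugates R (f x) (g x) t >] >]).
Proof.
move=> fP gP mP.
apply: (decides_exists_word
  (p := fun t x => `[< conjugates R (f x) (g x) t >]) mP).
have hP := wcomputes_word (computes_head n).
exact: (decides_pairs wordP (wcomputes_cat hP (computes_behead fP))
                            (wcomputes_cat (computes_behead gP) hP)).
Qed.

Lemma Gamma_computable :
  solvable_conjugacy_problem R -> computable2 (Gamma R).
Proof.
move=> conjP; apply/computable2P/computes_le.
pose short a b n := `[< exists2 t, size t <= n & `[< conjugates R a b t >] >].
pose q a b n := `[< conjugated R a b >] ==> short a b n.
(* Entry 0 is the candidate bound tried by the minimization; entries 1 and 2 are [n1] and [n2]. *)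
apply: (eq_decides (p := fun x =>
  `[< forall a, size a <= nth 0 x 1 -> `[< forall b, size b <= nth 0 x 2 ->
        q a b (nth 0 x 0) >] >])).
  move=> x; rewrite !nth_behead; apply/asboolP/idP => [H|/Gamma_leP H a lea].
    apply/Gamma_leP => a lea b leb ab.
    have /asboolP/(_ b leb)/implyP/(_ (asboolT ab)) := H a lea.
    by case/asboolP=> t tle /asboolP; exists t.
  apply/asboolP => b leb; apply/implyP => /asboolP ab; apply/asboolP.
  by have [t tle tP] := H a lea b leb ab; exists t => //; apply/asboolP.
apply: (decides_forall_word
  (p := fun a x => `[< forall b, size b <= nth 0 x 2 ->
  q a b (nth 0 x 0) >]) (m := fun x => nth 0 x 1)); first exact: computes_nth.
(* Each quantifier puts the code of its word in front and shifts the indices by one: here entry 0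
   codes [a], the candidate is entry 1 and [n2] is entry 3. *)
apply: (eq_decides (p := fun x => `[< forall b, size b <= nth 0 x 3 ->
  q (word (nth 0 x 0)) b (nth 0 x 1) >])).
  by move=> x; rewrite !nth_behead nth0.
apply: (decides_forall_word (p := fun b x => q (word (nth 0 x 0)) b (nth 0 x 1))
  (m := fun x => nth 0 x 3)); first exact: computes_nth.
apply: (eq_decides (p := fun x =>
  q (word (nth 0 x 1)) (word (nth 0 x 0)) (nth 0 x 2))).
  by move=> x; rewrite !nth_behead nth0.
have aP : wcomputes 5 (fun x => word (nth 0 x 1)).
  by apply: wcomputes_word; apply: computes_nth.
have bP : wcomputes 5 (fun x => word (nth 0 x 0)).
  by apply: wcomputes_word; apply: computes_nth.
apply: decides_imp; first exact: (decides_pairs conjP aP bP).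
by apply: decides_short_conjugator => //; apply: computes_nth.
Qed.

Lemma bounded_Gamma_conjugacy f :
  computable2 f -> (forall n1 n2, Gamma R n1 n2 <= f n1 n2) ->
  solvable_conjugacy_problem R.
Proof.
move=> fP Gf; apply/decidable_pairsP.
pose a x := word (nth 0 x 0); pose b x := word (nth 0 x 1).
have aP : wcomputes 2 a by apply: wcomputes_word; apply: computes_nth.
have bP : wcomputes 2 b by apply: wcomputes_word; apply: computes_nth.
(* The bound [f] is evaluated at the codes of the two words rather than at their lengths. Codes are
   at least as large as lengths, so [Gamma] at the codes still covers this pair, and [f] need not be
   monotone. *)
have := decides_short_conjugator aP bP (computes_app2 fP aP bP).
apply: eq_decides => x; apply/asboolP/asboolP => [[t _ /asboolP]|ab].
  by exists t.
have /Gamma_leP := Gf (wcode (a x)) (wcode (b x)).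
case/(_ (a x) (size_le_wcode _) (b x) (size_le_wcode _) ab) => t le tP.
by exists t => //; apply/asboolP.
Qed.

End Words.

Theorem proposition7p17 (X : finType) (R : set (seq X * seq X))
    (wordP : solvable_word_problem R)
    (enumR : enumerable_pairs (relations R)) :
  (solvable_conjugacy_problem R <->
     exists f : nat -> nat -> nat,
       computable2 f /\ forall n1 n2 : nat, Gamma R n1 n2 <= f n1 n2) /\
  (solvable_conjugacy_problem R -> computable2 (Gamma R)).
Proof.
split; last exact: Gamma_computable.
split=> [conjP|[f [fP Gf]]]; last exact: bounded_Gamma_conjugacy fP Gf.
by exists (Gamma R); split; first exact: Gamma_computable.
Qed.
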